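(* Let $G\in\mathfrak{R}H^\infty_{m\times p}$ and $K\in\mathfrak{R}H^\infty_{m\times q}$ be given by the minimal realization \[ \begin{bmatrix} G(z) & K(z)\end{bmatrix}=\begin{bmatrix} D_1 & D_2\end{bmatrix}+zC(I_n-zA)^{-1}\begin{bmatrix} B_1 & B_2\end{bmatrix}, \] with $A$ a stable $n\times n$ matrix. Assume that $T_GT_G^*-T_KT_K^*\geq 0$. Then there exists a function $F\in\mathfrak{R}H^\infty_{m\times r}$, for some $r\leq m$, of the form \[ F(z)=D_3+zC(I_n-zA)^{-1}B_3 \] (for some matrices $B_3$ of size $n\times r$ and $D_3$ of size $m\times r$), such that: (i) $T_GT_G^*-T_KT_K^*-T_FT_F^*=W_{obs}(P_3+P_2-P_1)W_{obs}^*$, where $P_3$ is the controllability Gramian of the pair $\{A,B_3\}$; (ii) $P_3+P_2-P_1$ is nonnegative. In particular, $T_GT_G^*-T_KT_K^*-T_FT_F^*$ is nonnegative and has rank at most $n$, and \[ G(e^{it})G(e^{it})^*-K(e^{it})K(e^{it})^*-F(e^{it})F(e^{it})^*=0\quad (t\in[0,2\pi]). \]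
   Context: $\mathfrak{R}H^\infty_{k\times l}$ denotes the set of $k\times l$ rational matrix functions with no poles in the closed unit disc $|z|\le 1$. A square matrix is stable if all its eigenvalues lie in the open unit disc. A realization is minimal if there is no realization of the same function of this form with a state matrix $A$ of smaller size (equivalently, it is observable and controllable). $\ell^2_+(\mathbb{C}^k)$ is the Hilbert space of square summable sequences $(x_0,x_1,\dots)$ with $x_j\in\mathbb{C}^k$. For a $k\times l$ matrix function $\Omega$ in $H^\infty$ (or $L^\infty$ on the unit circle) with Fourier coefficients $\Omega_j$, $T_\Omega:\ell^2_+(\mathbb{C}^l)\to\ell^2_+(\mathbb{C}^k)$ is the block Toeplitz operator whose $(i,j)$ block entry is $\Omega_{i-j}$ ($i,j\ge 0$). $W_{obs}=\operatorname{col}(CA^j)_{j\ge 0}:\mathbb{C}^n\to\ell^2_+(\mathbb{C}^m)$ is the observability operator of $\{C,A\}$, and for $j=1,2$, $P_j=\sum_{\nu\ge 0}A^\nu B_jB_j^*(A^* )^\nu$ is the controllability Gramian of $\{A,B_j\}$; likewise $P_3=\sum_{\nu\ge0}A^\nu B_3B_3^*(A^* )^\nu$. *)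

(* Defs.v *)
From HB Require Import structures.
From mathcomp Require Import all_boot all_order all_algebra.
From mathcomp Require Import all_classical all_reals all_analysis.
From mathcomp Require Import complex.
Set Implicit Arguments. Unset Strict Implicit. Unset Printing Implicit Defensive.
Import Order.TTheory GRing.Theory Num.Theory.
Import numFieldNormedType.Exports.
Local Open Scope ring_scope.
Local Open Scope classical_set_scope.

Section Defs.
Variable R : realType.
Local Notation C := R[i].

Definition adj m n (M : 'M[C]_(m, n)) : 'M[C]_(n, m) := (map_mx (@conjc R) M)^T.

Definition stable n (A : 'M[C]_n) : Prop :=
  forall lam : C, eigenvalue A lam -> `|lam| < 1.

Definition observable m n (Cm : 'M[C]_(m, n)) (A : 'M[C]_n) : Prop :=
  forall x : 'cV[C]_n, (forall j : nat, Cm *m A ^+ j *m x = 0) -> x = 0.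

Definition controllable n k (A : 'M[C]_n) (B : 'M[C]_(n, k)) : Prop :=
  forall y : 'rV[C]_n, (forall j : nat, y *m A ^+ j *m B = 0) -> y = 0.

Definition minimal_realization m n k (Cm : 'M[C]_(m, n)) (A : 'M[C]_n)
  (B : 'M[C]_(n, k)) : Prop := observable Cm A /\ controllable A B.

(* Taylor (= Fourier) coefficients of Omega(z) = D + z Cm (I - zA)^{-1} B:
   Omega_0 = D, Omega_j = Cm A^(j-1) B for j >= 1 *)
Definition coef m n k (D : 'M[C]_(m, k)) (Cm : 'M[C]_(m, n)) (A : 'M[C]_n)
  (B : 'M[C]_(n, k)) (j : nat) : 'M[C]_(m, k) :=
  if j is j'.+1 then Cm *m A ^+ j' *m B else D.

(* (i,l) block entry of T_Omega adj(T_Omega), for T_Omega the block lower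
   triangular Toeplitz operator with (i,j) block Omega_{i-j} (0 if i < j):
   sum_{j <= min(i,l)} Omega_{i-j} adj(Omega_{l-j})  (a finite sum) *)
Definition TTstar m k (Om : nat -> 'M[C]_(m, k)) (i l : nat) : 'M[C]_m :=
  \sum_(j < (minn i l).+1) Om (i - j)%N *m adj (Om (l - j)%N).

Definition realize m n k (D : 'M[C]_(m, k)) (Cm : 'M[C]_(m, n)) (A : 'M[C]_n)
  (B : 'M[C]_(n, k)) (z : C) : 'M[C]_(m, k) :=
  D + z *: (Cm *m invmx (1%:M - z *: A) *m B).

Definition gramian_partial n k (A : 'M[C]_n) (B : 'M[C]_(n, k)) (N : nat)
  : 'M[C]_n :=
  \sum_(nu < N) A ^+ nu *m B *m adj B *m adj A ^+ nu.
Definition is_gramian n k (A : 'M[C]_n) (B : 'M[C]_(n, k)) (P : 'M[C]_n)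
  : Prop :=
  forall a b : 'I_n,
    (fun N : nat => complex.Re (gramian_partial A B N a b)) @ \oo --> complex.Re (P a b) /\
    (fun N : nat => complex.Im (gramian_partial A B N a b)) @ \oo --> complex.Im (P a b).

Definition psd n (M : 'M[C]_n) : Prop :=
  forall x : 'cV[C]_n, 0 <= (adj x *m M *m x) 0 0.

(* The N-th finite section (blocks 0..N-1) of an operator on l^2_+(C^m)
   given by its block entries H i l : 'M_m, as an (N*m) x (N*m) matrix. *)
Definition sec_idx N m (a : 'I_(N * m)) : 'I_N * 'I_m :=
  enum_val (cast_ord (esym (mxvec_cast N m)) a).
Definition section m (H : nat -> nat -> 'M[C]_m) (N : nat) : 'M[C]_(N * m) :=
  \matrix_(a, b) H (sec_idx a).1 (sec_idx b).1 (sec_idx a).2 (sec_idx b).2.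

(* bounded block operator H >= 0  iff every finite section is psd *)
Definition op_nonneg m (H : nat -> nat -> 'M[C]_m) : Prop :=
  forall N, psd (section H N).
(* rank H <= r iff every finite section has rank <= r *)
Definition op_rank_le m (H : nat -> nat -> 'M[C]_m) (r : nat) : Prop :=
  forall N, (\rank (section H N) <= r)%N.

(* block entries of W_obs X adj(W_obs) : (i,l) block = Cm A^i X adj(A)^l adj(Cm) *)
Definition WXWstar m n (Cm : 'M[C]_(m, n)) (A : 'M[C]_n) (X : 'M[C]_n)
  (i l : nat) : 'M[C]_m :=
  Cm *m A ^+ i *m X *m adj A ^+ l *m adj Cm.

End Defs.

(* Main.v *)
(** Read backwards in time, [T_G^* u] and [T_K^* u] are the outputs of the system
    [x' = A^* x + C^* u], [y_j = B_j^* x + D_j^* u] started at [x = 0], so the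
    quadratic form of [H := T_G T_G^* - T_K T_K^*] at [u] is the total supply
    [sum |y_1|^2 - |y_2|^2], and [H >= 0] says that this system is dissipative.
    Its required supply [X x := inf {<H u, u> | W_obs^* u = x}] is a nonnegative
    quadratic form (finite by observability), obtained here as the decreasing
    limit of its finite-horizon versions.  It satisfies the dissipation
    inequality, i.e. the form [x^* X x + supply(x, u) - x'^* X x'] is nonnegative,
    and by dynamic programming the minimum of that form over the fibres of
    [(x, u) |-> x'] is [0], so its kernel has dimension at least [n] and its rank is
    at most [m].  Factoring it as [col(B_3, D_3) col(B_3, D_3)^*] gives a Stein
    equation for [X] which makes [H - T_F T_F^*] and [W_obs X W_obs^*] obey the same
    displacement recursion.  Finally [A^N -> 0], a consequence of the convergence of
    the Gramians and of controllability, identifies [X] with [P_3 + P_2 - P_1]. *)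

Require Import Defs.
From HB Require Import structures.
From mathcomp Require Import all_boot all_order all_algebra.
From mathcomp Require Import all_classical all_reals all_analysis.
From mathcomp Require Import complex spectral ring lra.
Import Order.TTheory GRing.Theory Num.Theory.
Import numFieldNormedType.Exports.
Local Open Scope ring_scope.

Set Implicit Arguments.
Unset Strict Implicit.
Unset Printing Implicit Defensive.

(** * Adjoints and nonnegative matrices *)

Section Adjoint.
Variable R : realType.
Local Notation C := R[i].

Lemma adjE m n (M : 'M[C]_(m, n)) i j : adj M i j = conjc (M j i).
Proof. by rewrite !mxE. Qed.

Lemma adjK m n (M : 'M[C]_(m, n)) : adj (adj M) = M.
Proof. by apply/matrixP=> i j; rewrite !adjE conjcK. Qed.

Lemma adjM m n k (M : 'M[C]_(m, n)) (N : 'M[C]_(n, k)) :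
  adj (M *m N) = adj N *m adj M.
Proof. by rewrite /adj map_mxM trmx_mul. Qed.

Lemma adjD m n (M N : 'M[C]_(m, n)) : adj (M + N) = adj M + adj N.
Proof. by rewrite /adj map_mxD linearD. Qed.

Lemma adjN m n (M : 'M[C]_(m, n)) : adj (- M) = - adj M.
Proof. by rewrite /adj map_mxN linearN. Qed.

Lemma adjB m n (M N : 'M[C]_(m, n)) : adj (M - N) = adj M - adj N.
Proof. by rewrite adjD adjN. Qed.

Lemma adjZmx m n (a : C) (M : 'M[C]_(m, n)) : adj (a *: M) = conjc a *: adj M.
Proof. by rewrite /adj map_mxZ linearZ. Qed.

Lemma adj0 m n : adj (0 : 'M[C]_(m, n)) = 0.
Proof. by rewrite /adj map_mx0 trmx0. Qed.

Lemma adj1mx n : adj (1%:M : 'M[C]_n) = 1%:M.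
Proof. by rewrite /adj map_mx1 trmx1. Qed.

Lemma adj_sum m n (I : Type) (r : seq I) (P : pred I) (F : I -> 'M[C]_(m, n)) :
  adj (\sum_(i <- r | P i) F i) = \sum_(i <- r | P i) adj (F i).
Proof. exact: (big_morph _ (@adjD m n) (@adj0 m n)). Qed.

Lemma adjX n (A : 'M[C]_n) j : adj (A ^+ j) = adj A ^+ j.
Proof.
elim: j => [|j IHj]; first by rewrite !expr0 adj1mx.
by rewrite exprSr exprS -!mulmxE adjM IHj.
Qed.

Lemma adj_row_mx m n k (M : 'M[C]_(m, n)) (N : 'M[C]_(m, k)) :
  adj (row_mx M N) = col_mx (adj M) (adj N).
Proof. by rewrite /adj map_row_mx tr_row_mx. Qed.

Lemma adj_col_mx m n k (M : 'M[C]_(m, n)) (N : 'M[C]_(k, n)) :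
  adj (col_mx M N) = row_mx (adj M) (adj N).
Proof. by rewrite /adj map_col_mx tr_col_mx. Qed.

Lemma adj_mul_self m n (M : 'M[C]_(m, n)) j :
  (adj M *m M) j j = \sum_i `|M i j| ^+ 2.
Proof.
by rewrite mxE; apply: eq_bigr => i _; rewrite adjE mulrC -sqr_normc.
Qed.

Lemma adj_mul_self_eq0 m n (M : 'M[C]_(m, n)) : adj M *m M = 0 -> M = 0.
Proof.
move=> M0; apply/matrixP => i j; rewrite mxE.
have : \sum_i `|M i j| ^+ 2 = 0 by rewrite -adj_mul_self M0 mxE.
move/eqP; rewrite psumr_eq0 => [/allP/(_ i)|k _]; last exact: exprn_ge0.
by rewrite mem_index_enum => /(_ isT); rewrite sqrf_eq0 normr_eq0 => /eqP.
Qed.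

Lemma conjC_conjc (x : C) : (x^*)%R = conjc x.
Proof.
have [->|x0] := eqVneq x 0; first by rewrite rmorph0 conjc0.
by apply: (mulfI x0); rewrite -normCK sqr_normc.
Qed.

Definition qform n (M : 'M[C]_n) (v : 'cV[C]_n) : C := (adj v *m M *m v) 0 0.

Lemma qformDZ n (M : 'M[C]_n) (x y : 'cV[C]_n) (a b : C) : conjc a = b ->
  qform M (x + a *: y) = qform M x + a * (adj x *m M *m y) 0 0 +
    b * (adj y *m M *m x) 0 0 + a * b * qform M y.
Proof.
move=> <-; rewrite /qform adjD adjZmx !mulmxDl !mulmxDr -!scalemxAl -!scalemxAr.
move: (adj x *m M *m x) (adj x *m M *m y) (adj y *m M *m x) (adj y *m M *m y).
by move=> t1 t2 t3 t4; rewrite !mxE; ring.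
Qed.

Lemma conjci : conjc 'i%C = - 'i%C :> C.
Proof. by apply/eqP; rewrite eq_complex /= oppr0 !eqxx. Qed.

(** Matrix entries are recovered from values of the form, so convergence and equality of matrices
    can be tested on [qform] alone. *)
Lemma polarization n (M : 'M[C]_n) (x y : 'cV[C]_n) :
  4 * (adj x *m M *m y) 0 0 =
  (qform M (x + 1 *: y) - qform M (x + (-1) *: y)) -
  'i%C * (qform M (x + 'i%C *: y) - qform M (x + (- 'i%C) *: y)).
Proof.
have conjNi : conjc (- 'i%C) = 'i%C :> C by rewrite -conjci conjcK.
have conjN1 : conjc (- 1) = -1 :> C by rewrite rmorphN1.
(* An abstract [w] with [w * w = -1] stands for ['i], so that the identity is within reach of
   [ring]. *)
have comb (w a b c d q1 q2 q3 q4 : C) : w * w = -1 ->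
    q1 = c + 1 * a + 1 * b + 1 * 1 * d ->
    q2 = c + (-1) * a + (-1) * b + (-1) * (-1) * d ->
    q3 = c + w * a + (- w) * b + w * (- w) * d ->
    q4 = c + (- w) * a + w * b + (- w) * w * d ->
    4 * a = (q1 - q2) - w * (q3 - q4).
  move=> ww -> -> -> ->.
  transitivity (2 * a + 2 * b - (w * w) * (2 * a - 2 * b)); last by ring.
  by rewrite ww; ring.
exact: (comb _ _ _ _ _ _ _ _ _ (sqr_i R) (qformDZ M x y (conjc1 R))
  (qformDZ M x y conjN1) (qformDZ M x y conjci) (qformDZ M x y conjNi)).
Qed.

Lemma adj_delta_mul n (M : 'M[C]_n) a b :
  (adj (delta_mx a 0 : 'cV_n) *m M *m (delta_mx b 0 : 'cV_n)) 0 0 = M a b.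
Proof.
have -> : adj (delta_mx a 0 : 'cV[C]_n) = delta_mx 0 a.
  by apply/matrixP => i j; rewrite adjE !mxE andbC rmorph_nat.
by rewrite -rowE -colE !mxE.
Qed.

(** The order on [C] makes every value of the form real. Its values at [x], [y], [x + y] and
    [x + 'i *: y], for unit vectors [x] and [y], tie the real and imaginary parts of the [(a, b)]
    and [(b, a)] entries. *)
Lemma psd_adj n (M : 'M[C]_n) : psd M -> adj M = M.
Proof.
move=> M0; apply/matrixP => a b; rewrite adjE.
rewrite -(adj_delta_mul M b a) -(adj_delta_mul M a b).
set x := delta_mx a 0; set y := delta_mx b 0.
have q0 z : complex.Im (qform M z) = 0 by apply/ger0_Im/M0.
have h1 := etrans (esym (q0 _)) (congr1 (@complex.Im R) (qformDZ M x y (conjc1 R))).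
have h2 := etrans (esym (q0 _)) (congr1 (@complex.Im R) (qformDZ M x y conjci)).
have h3 := q0 x; have h4 := q0 y.
move: h1 h2.
case: (qform M x) h3 => x1 x2 /= ->; case: (qform M y) h4 => y1 y2 /= ->.
case: ((adj x *m M *m y) 0 0) => a1 a2; case: ((adj y *m M *m x) 0 0) => b1 b2 /=.
move=> h1 h2; apply/eqP; rewrite eq_complex /=; apply/andP; split; apply/eqP; lra.
Qed.

(** Spectral theorem: [M] is unitarily diagonalizable with nonnegative eigenvalues, whose square
    roots are taken. *)
Lemma psdP n (M : 'M[C]_n) : psd M -> exists V : 'M[C]_n, M = V *m adj V.
Proof.
move=> M0; have MH := psd_adj M0.
have tE (N : 'M[C]_n) : map_mx Num.conj (N^T) = adj N.
  by apply/matrixP => i j; rewrite !mxE conjC_conjc.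
have : M \is normalmx by apply/normalmxP; rewrite tE MH.
move=> /orthomx_spectralP; set P := spectralmx M; set d := spectral_diag M => ME.
have Pu := spectral_unitarymx M; rewrite -/P in Pu.
have PE : invmx P = adj P by rewrite invmx_unitary // tE.
have PP : P *m adj P = 1%:M by rewrite -tE; apply/unitarymxP.
have d0 i : 0 <= d 0 i.
  have := M0 (adj P *m delta_mx i 0).
  rewrite {1}ME PE adjM adjK !mulmxA -[_ *m P *m adj P]mulmxA PP mulmx1.
  rewrite -[_ *m P *m adj P]mulmxA PP mulmx1 adj_delta_mul mxE eqxx mulr1n.
  by [].
pose S := diag_mx (map_mx sqrtC d).
have dE : diag_mx d = S *m adj S.
  apply/matrixP => i j; rewrite mul_diag_mx !mxE.
  case: (eqVneq i j) => [->|_]; last first.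
    by rewrite !mulr0n conjc0 mulr0.
  by rewrite !mulr1n -conjC_conjc geC0_conj ?sqrtC_ge0 // -expr2 sqrtCK.
exists (adj P *m S).
by rewrite adjM adjK mulmxA -(mulmxA (adj P)) -dE -PE.
Qed.

End Adjoint.

(** * Nonnegative forms: rank factorization, minimization over fibres, observability *)

Section Psd.
Variable R : realType.
Local Notation C := R[i].

Lemma qform_conj k n (M : 'M[C]_k) (W : 'M[C]_(k, n)) v :
  qform (adj W *m M *m W) v = qform M (W *m v).
Proof. by rewrite /qform adjM !mulmxA. Qed.

Lemma psd_conj k n (M : 'M[C]_k) (W : 'M[C]_(k, n)) :
  psd M -> psd (adj W *m M *m W).
Proof. by move=> M0 v; have := M0 (W *m v); rewrite -[X in 0 <= X]qform_conj. Qed.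

Lemma psd_mul_eq0 k n (M : 'M[C]_k) (W : 'M[C]_(k, n)) :
  psd M -> adj W *m M *m W = 0 -> M *m W = 0.
Proof.
move=> /psdP[V ->] h; rewrite -mulmxA.
suff -> : adj V *m W = 0 by rewrite mulmx0.
by apply: adj_mul_self_eq0; rewrite adjM adjK !mulmxA -h !mulmxA.
Qed.

Lemma psd_rank_factor k (M : 'M[C]_k) :
  psd M -> exists V : 'M[C]_(k, \rank M), M = V *m adj V.
Proof.
move=> M0.
(* [cb] is a basis of the column space of [M] and [c] a left inverse of it. Hence [M] equals
   [cb *m (c *m M *m adj c) *m adj cb], and only the small middle matrix has to be factored. *)
have [cb [c cK]] : exists (cb : 'M[C]_(k, \rank M)) c, cb *m c *m M = M.
  have cK : col_base M *m pinvmx (col_base M) *m (col_base M *m row_base M)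
      = col_base M *m row_base M.
    rewrite mulmxA -(mulmxA (col_base M)).
    by rewrite mulVpmx ?col_base_full // mulmx1.
  by exists (col_base M), (pinvmx (col_base M)); rewrite mulmx_base in cK.
have [T TE] := psdP (psd_conj (adj c) M0).
exists (cb *m T); rewrite adjM mulmxA -(mulmxA cb) -TE adjK !mulmxA cK.
have /(congr1 (@adj R _ _)) := cK; rewrite !adjM (psd_adj M0) => {1}<-.
by rewrite mulmxA.
Qed.

Lemma qformD k (M : 'M[C]_k) x y :
  qform M (x + y) = qform M x + (adj x *m M *m y) 0 0 +
    (adj y *m M *m x) 0 0 + qform M y.
Proof.
by have := qformDZ M x y (conjc1 R); rewrite scale1r !mul1r.
Qed.

(** Completing the square: a minimizer on the fibre over [x] can be chosen linear in [x], namely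
    [Z *m x] with the range of [Z] orthogonal to the kernel of [L] for the form [M]. *)
Lemma min_qform_fiber k n (M : 'M[C]_k) (L : 'M[C]_(n, k)) (Z0 : 'M[C]_(k, n)) :
  psd M -> L *m Z0 = 1%:M ->
  exists2 Z : 'M[C]_(k, n), L *m Z = 1%:M &
    forall v, qform (adj Z *m M *m Z) (L *m v) <= qform M v.
Proof.
move=> M0 LZ0; have MH := psd_adj M0.
pose Q := 1%:M - Z0 *m L.
have LQ : L *m Q = 0 by rewrite /Q mulmxBr mulmx1 mulmxA LZ0 mul1mx subrr.
(* Solvability of the normal equations, [Q] being a projection onto the kernel of [L]: whatever
   [adj Q *m M *m Q] annihilates is already annihilated by [M *m Q], because [M] is nonnegative. *)
have /submxP[Y YE] : (adj Z0 *m M *m Q <= adj Q *m M *m Q)%MS.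
  rewrite submxE; apply/eqP; move: (mulmx_coker (adj Q *m M *m Q)).
  move: (cokermx _) => K K0.
  rewrite -!mulmxA; suff -> : M *m (Q *m K) = 0 by rewrite mulmx0.
  apply: psd_mul_eq0 => //.
  have -> : adj (Q *m K) *m M *m (Q *m K) = adj K *m (adj Q *m M *m Q *m K).
    by rewrite adjM !mulmxA.
  by rewrite K0 mulmx0.
pose Z := Z0 - Q *m adj Y.
have LZ : L *m Z = 1%:M by rewrite /Z mulmxBr mulmxA LQ mul0mx subr0.
have ZMQ : adj Z *m M *m Q = 0.
  by rewrite /Z adjB adjM adjK !mulmxBl YE !mulmxA subrr.
have QMZ : adj Q *m M *m Z = 0.
  by have /(congr1 (@adj R _ _)) := ZMQ; rewrite !adjM adjK MH adj0 mulmxA.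
exists Z => // v; rewrite qform_conj.
pose w := v + adj Y *m (L *m v).
have vE : v = Z *m (L *m v) + Q *m w.
  rewrite /w mulmxDr /Z mulmxBl addrACA -!mulmxA addNr addr0.
  by rewrite /Q mulmxBl mul1mx -!mulmxA addrC subrK.
rewrite {2}vE qformD.
have -> : adj (Z *m (L *m v)) *m M *m (Q *m w) = 0.
  have -> : adj (Z *m (L *m v)) *m M *m (Q *m w) =
      adj (L *m v) *m (adj Z *m M *m Q) *m w by rewrite !adjM !mulmxA.
  by rewrite ZMQ mulmx0 mul0mx.
have -> : adj (Q *m w) *m M *m (Z *m (L *m v)) = 0.
  have -> : adj (Q *m w) *m M *m (Z *m (L *m v)) =
      adj w *m (adj Q *m M *m Z) *m (L *m v) by rewrite !adjM !mulmxA.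
  by rewrite QMZ mulmx0 mul0mx.
by rewrite !mxE !addr0 lerDl; apply: M0.
Qed.

(** The difference is a nonnegative form vanishing on the range of [Z], hence it annihilates that
    range, which has dimension [n] since [Z] has a left inverse. *)
Lemma rank_min_qform_fiber k n (M : 'M[C]_k) (L : 'M[C]_(n, k)) (Z : 'M[C]_(k, n)) :
  psd (M - adj L *m (adj Z *m M *m Z) *m L) -> L *m Z = 1%:M ->
  (\rank (M - adj L *m (adj Z *m M *m Z) *m L)%R <= k - n)%N.
Proof.
set N := M - _ => N0 LZ.
have NZ : N *m Z = 0.
  apply: psd_mul_eq0 => //.
  have ZL : adj Z *m adj L = 1%:M by rewrite -adjM LZ adj1mx.
  by rewrite /N mulmxBr mulmxBl !mulmxA ZL mul1mx -!mulmxA LZ mulmx1 subrr.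
have rZ : \rank Z = n.
  apply/eqP; rewrite eqn_leq rank_leq_col /=.
  by have := mxrankM_maxr L Z; rewrite LZ mxrank1.
have := mulmx0_rank_max NZ; rewrite rZ => h.
by rewrite leq_subRL ?(leq_trans _ h) ?leq_addl // addnC.
Qed.

(** The row spaces of the truncated observability matrices grow and their ranks are bounded by [n].
    At a horizon of maximal rank they contain every row [Cm *m A ^+ j], and observability makes them
    everything. *)
Lemma observable_right_inverse m n (Cm : 'M[C]_(m, n)) (A : 'M[C]_n) :
  observable Cm A -> exists N0 (U : nat -> 'M[C]_(m, n)),
  forall N, (N0 <= N)%N -> \sum_(i < N) adj (Cm *m A ^+ i) *m U i = 1%:M.
Proof.
move=> obs; pose S N := (\sum_(i < N) <<Cm *m A ^+ i>>)%MS.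
have Sle N j : (j < N)%N -> (Cm *m A ^+ j <= S N)%MS.
  by move=> jN; apply: (sumsmx_sup (Ordinal jN)) => //; rewrite genmxE.
pose P r := `[< exists N, \rank (S N) = r >].
have exP : exists r, P r by exists (\rank (S 0)); apply/asboolP; exists 0%N.
have Pn r : P r -> (r <= n)%N by move=> /asboolP[N <-]; exact: rank_leq_col.
case: (ex_maxnP exP Pn) => _ /asboolP[N <-] maxN.
have CS j : (Cm *m A ^+ j <= S N)%MS.
  pose N' := maxn N j.+1.
  have NN' : (S N <= S N')%MS.
    apply/sumsmx_subP => i _; rewrite genmxE; apply: Sle.
    by rewrite (leq_trans (ltn_ord i)) // leq_maxl.
  have : (\rank (S N') <= \rank (S N))%N by apply: maxN; apply/asboolP; exists N'.
  rewrite (geq_leqif (mxrank_leqif_sup NN')) => /(submx_trans _); apply.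
  by apply: Sle; rewrite leq_maxr.
have : (1%:M <= S N)%MS.
  rewrite submxE mul1mx; apply/eqP/matrixP => i a; rewrite [RHS]mxE.
  suff /colP/(_ i) : col a (cokermx (S N)) = 0 by rewrite !mxE.
  apply: obs => j; rewrite colE mulmxA.
  by have := CS j; rewrite submxE => /eqP ->; rewrite mul0mx.
move=> /sub_sumsmxP[u uE].
have ex i : exists V : 'M[C]_(n, m), u i *m <<Cm *m A ^+ i>>%MS = V *m (Cm *m A ^+ i).
  by apply/submxP; rewrite (submx_trans (submxMl _ _)) // genmxE.
have [V VE] := choice ex.
(* Padding by zero beyond [N] keeps the identity valid at every longer horizon. *)
exists N, (fun i => if insub i is Some i' then adj (V i') else 0) => N' NN'.
have /(congr1 (@adj R _ _)) := uE; rewrite adj1mx adj_sum => ->.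
rewrite -(subnKC NN') big_split_ord /=; set rest := (X in _ + X = _).
have -> : rest = 0.
  by apply: big1 => i _; rewrite insubN ?mulmx0 // -leqNgt leq_addr.
by rewrite addr0; apply: eq_bigr => i _; rewrite VE !adjM valK.
Qed.

End Psd.

(** * Finite sections and displacement recursions *)

Section Sections.
Variable R : realType.
Local Notation C := R[i].

(* The column of the blocks [U 0, ..., U (N-1)], in the row order of [section]. *)
Definition block_col m k N (U : nat -> 'M[C]_(m, k)) : 'M[C]_(N * m, k) :=
  \matrix_(a, b) U (sec_idx a).1 (sec_idx a).2 b.

Lemma sec_idxK N m (i : 'I_N) (j : 'I_m) : sec_idx (mxvec_index i j) = (i, j).
Proof. by rewrite /sec_idx /mxvec_index cast_ordK enum_rankK. Qed.

Lemma mxvec_index_sec N m (a : 'I_(N * m)) :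
  mxvec_index (sec_idx a).1 (sec_idx a).2 = a.
Proof.
by case/mxvec_indexP: a => i j; rewrite sec_idxK.
Qed.

Lemma sum_sec_idx (V : nmodType) N m (F : 'I_N -> 'I_m -> V) :
  \sum_(a < N * m) F (sec_idx a).1 (sec_idx a).2 = \sum_(i < N) \sum_(j < m) F i j.
Proof.
rewrite pair_bigA (reindex (@sec_idx N m)) //=.
apply: onW_bij; exists (fun p => mxvec_index p.1 p.2) => [a|[i j]] /=.
  exact: mxvec_index_sec.
exact: sec_idxK.
Qed.

Lemma block_colP m k N (Z : 'M[C]_(N * m, k)) :
  exists U : nat -> 'M[C]_(m, k), Z = block_col N U.
Proof.
exists (fun i => if insub i is Some i' then
   \matrix_(j, b) Z (mxvec_index i' j) b else 0).
by apply/matrixP => a b; rewrite mxE valK mxE mxvec_index_sec.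
Qed.

Lemma adj_block_col_mul m k k' N (U : nat -> 'M[C]_(m, k)) (V : nat -> 'M[C]_(m, k')) :
  adj (block_col N U) *m block_col N V = \sum_(i < N) adj (U i) *m V i.
Proof.
apply/matrixP => a b; rewrite mxE summxE.
under eq_bigr do rewrite adjE !mxE.
rewrite (sum_sec_idx (fun i j => conjc (U i j a) * V i j b)).
by apply: eq_bigr => i _; rewrite mxE; apply: eq_bigr => j _; rewrite adjE.
Qed.

Lemma section_mul_block_col m k (H : nat -> nat -> 'M[C]_m) N (V : nat -> 'M[C]_(m, k)) :
  section H N *m block_col N V = block_col N (fun i => \sum_(l < N) H i l *m V l).
Proof.
apply/matrixP => a b; rewrite !mxE summxE.
under eq_bigr do rewrite !mxE.
rewrite (sum_sec_idx (fun l j => H (sec_idx a).1 l (sec_idx a).2 j * V l j b)).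
by apply: eq_bigr => i _; rewrite mxE.
Qed.

Definition kform m (H : nat -> nat -> 'M[C]_m) N (u : nat -> 'cV[C]_m) : C :=
  (\sum_(i < N) \sum_(l < N) adj (u i) *m H i l *m u l) 0 0.

Lemma qform_section m (H : nat -> nat -> 'M[C]_m) N (u : nat -> 'cV[C]_m) :
  qform (section H N) (block_col N u) = kform H N u.
Proof.
rewrite /qform -mulmxA section_mul_block_col adj_block_col_mul /kform.
congr (fun_of_matrix _ _ _); apply: eq_bigr => i _; rewrite mulmx_sumr.
by apply: eq_bigr => l _; rewrite mulmxA.
Qed.

(** * States of the backward system and kernels with a displacement recursion *)

Section Kernel.
Variables (m n : nat) (Cm : 'M[C]_(m, n)) (A : 'M[C]_n).

(* [W_obs^* u] for [u] supported on [0, N); [u 0] is the input applied last. *)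
Definition ostate k N (u : nat -> 'M[C]_(m, k)) : 'M[C]_(n, k) :=
  \sum_(i < N) adj (Cm *m A ^+ i) *m u i.

Lemma ostateS k N (u : nat -> 'M[C]_(m, k)) :
  ostate N.+1 u = adj A *m ostate N (fun i => u i.+1) + adj Cm *m u 0%N.
Proof.
rewrite /ostate big_ord_recl expr0 mulmx1 addrC; congr (_ + _).
rewrite mulmx_sumr; apply: eq_bigr => i _.
by rewrite lift0 exprSr -mulmxE !adjM !mulmxA.
Qed.

Lemma ostate_block_col k N (u : nat -> 'M[C]_(m, k)) :
  ostate N u = adj (block_col N (fun i => Cm *m A ^+ i)) *m block_col N u.
Proof. by rewrite adj_block_col_mul. Qed.

(** A kernel is encoded by its border and by its increment along diagonals. The triple [E], [G], [K]
    is at once the supply rate of the quadratic form and a finite set of data that determines the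
    infinite kernel. *)
Definition stein_kernel (E : 'M[C]_n) (G : 'M[C]_(n, m)) (K : 'M[C]_m)
    (H : nat -> nat -> 'M[C]_m) : Prop :=
  [/\ H 0%N 0%N = K,
      forall i, H i.+1 0%N = Cm *m A ^+ i *m G,
      forall l, H 0%N l.+1 = adj G *m adj A ^+ l *m adj Cm &
      forall i l, H i.+1 l.+1 = H i l + Cm *m A ^+ i *m E *m adj A ^+ l *m adj Cm].

Lemma stein_kernel_uniq E G K H H' :
  stein_kernel E G K H -> stein_kernel E G K H' -> forall i l, H i l = H' i l.
Proof.
move=> [h1 h2 h3 h4] [k1 k2 k3 k4]; elim=> [|i IHi] [|l].
- by rewrite h1 k1.
- by rewrite h3 k3.
- by rewrite h2 k2.
- by rewrite h4 k4 IHi.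
Qed.

Lemma stein_kernelB E G K H E' G' K' H' :
  stein_kernel E G K H -> stein_kernel E' G' K' H' ->
  stein_kernel (E - E') (G - G') (K - K') (fun i l => H i l - H' i l).
Proof.
move=> [h1 h2 h3 h4] [k1 k2 k3 k4]; split=> [|i|l|i l].
- by rewrite h1 k1.
- by rewrite h2 k2 mulmxBr.
- by rewrite h3 k3 adjB !mulmxBl.
- by rewrite h4 k4 mulmxBr !mulmxBl opprD addrACA.
Qed.

(** The term [j = 0] of the [(i.+1, l.+1)] sum is the diagonal increment; the other terms form the
    [(i, l)] sum. *)
Lemma stein_kernel_TTstar k (B : 'M[C]_(n, k)) (D : 'M[C]_(m, k)) :
  stein_kernel (B *m adj B) (B *m adj D) (D *m adj D) (TTstar (coef D Cm A B)).
Proof.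
split=> [|i|l|i l]; rewrite /TTstar.
- by rewrite big_ord1.
- by rewrite minn0 big_ord1 /= !mulmxA.
- by rewrite min0n big_ord1 /= !adjM adjX adjK !mulmxA.
- rewrite minnSS big_ord_recl addrC; congr (_ + _).
  by rewrite !subn0 /= !adjM adjX !mulmxA.
Qed.

Lemma stein_kernel_WXWstar X : adj X = X ->
  stein_kernel (A *m X *m adj A - X) (A *m X *m adj Cm) (Cm *m X *m adj Cm)
    (WXWstar Cm A X).
Proof.
move=> XH; split=> [|i|l|i l]; rewrite /WXWstar.
- by rewrite !expr0 !mulmx1.
- by rewrite expr0 mulmx1 exprSr -mulmxE !mulmxA.
- by rewrite expr0 mulmx1 !adjM XH adjK exprS -mulmxE !mulmxA.
- rewrite mulmxBr !mulmxBl addrC exprSr exprS -!mulmxE !mulmxA.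
  by rewrite subrK.
Qed.

Lemma section_WXWstar X N :
  section (WXWstar Cm A X) N =
  block_col N (fun i => Cm *m A ^+ i) *m X *m
    adj (block_col N (fun i => Cm *m A ^+ i)).
Proof.
apply/matrixP => a b; rewrite mxE.
have -> : WXWstar Cm A X (sec_idx a).1 (sec_idx b).1 =
    Cm *m A ^+ (sec_idx a).1 *m X *m adj (Cm *m A ^+ (sec_idx b).1).
  by rewrite /WXWstar adjM adjX !mulmxA.
rewrite !mxE; apply: eq_bigr => i _; rewrite !adjE !mxE.
by congr (_ * _); apply: eq_bigr => j _; rewrite !mxE.
Qed.

(** Total supply accumulates one step at a time: the diagonal increments sum to the [E] term in the
    state, and block row and column [0] give the [G] and [K] terms in the last input [u 0]. *)
Lemma kformS E G K H N (u : nat -> 'cV[C]_m) : stein_kernel E G K H ->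
  kform H N.+1 u = kform H N (fun i => u i.+1) +
    qform (block_mx E G (adj G) K)
      (col_mx (ostate N (fun i => u i.+1)) (u 0%N)).
Proof.
move=> [h1 h2 h3 h4]; set x := ostate _ _.
have adjx : adj x = \sum_(i < N) adj (u i.+1) *m (Cm *m A ^+ i).
  by rewrite /x adj_sum; apply: eq_bigr => i _; rewrite adjM adjK.
have xE : x = \sum_(i < N) adj A ^+ i *m adj Cm *m u i.+1.
  by apply: eq_bigr => i _; rewrite adjM adjX.
rewrite /kform /qform adj_col_mx mul_row_block mul_row_col.
set S := \sum_(i < N) _; set T := (X in _ = _ + fun_of_matrix X 0 0).
transitivity ((S + T) 0 0); last by rewrite mxE.
congr (fun_of_matrix _ _ _); rewrite /S /T {S T}.
rewrite big_ord_recl big_ord_recl h1.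
under eq_bigr do rewrite lift0 h3.
under [X in _ + X = _]eq_bigr do rewrite big_ord_recl lift0 h2.
rewrite big_split /=.
have -> : \sum_(i < N) adj (u 0%N) *m (adj G *m adj A ^+ i *m adj Cm) *m u i.+1 =
    adj (u 0%N) *m adj G *m x.
  by rewrite xE mulmx_sumr; apply: eq_bigr => i _; rewrite !mulmxA.
have -> : \sum_(i < N) adj (u i.+1) *m (Cm *m A ^+ i *m G) *m u 0%N =
    adj x *m G *m u 0%N.
  by rewrite adjx !mulmx_suml; apply: eq_bigr => i _; rewrite !mulmxA.
have -> : \sum_(i < N) \sum_(l < N)
      adj (u (lift ord0 i)) *m H (lift ord0 i) (lift ord0 l) *m u (lift ord0 l) =
    \sum_(i < N) \sum_(l < N) adj (u i.+1) *m H i l *m u l.+1 + adj x *m E *m x.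
  rewrite adjx !mulmx_suml -big_split /=; apply: eq_bigr => i _.
  rewrite xE mulmx_sumr -big_split /=; apply: eq_bigr => l _.
  by rewrite -[bump 0 i]/i.+1 -[bump 0 l]/l.+1 h4 mulmxDr mulmxDl !mulmxA.
rewrite !mulmxDl.
move: (\sum_(i < N) _) (adj x *m E *m x) (adj x *m G *m _) (adj _ *m adj G *m x).
move=> S t1 t2 t3; move: (adj (u 0%N) *m K *m u 0%N) => t4.
by apply/matrixP => a b; rewrite !mxE; ring.
Qed.

End Kernel.
End Sections.

(** * Limits of complex matrices *)

Section ComplexLimits.
Variable R : realType.
Local Notation C := R[i].
Local Open Scope classical_set_scope.

Definition ccvg (u : nat -> C) (l : C) : Prop :=
  (fun N => complex.Re (u N)) @ \oo --> complex.Re l /\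
  (fun N => complex.Im (u N)) @ \oo --> complex.Im l.

Lemma ccvg_cst (a : C) : ccvg (fun=> a) a.
Proof. by split; exact: cvg_cst. Qed.

Lemma ReD (x y : C) : complex.Re (x + y) = complex.Re x + complex.Re y.
Proof. by case: x y => [a b] [c d]. Qed.

Lemma ImD (x y : C) : complex.Im (x + y) = complex.Im x + complex.Im y.
Proof. by case: x y => [a b] [c d]. Qed.

Lemma ccvgD u v a b : ccvg u a -> ccvg v b -> ccvg (fun N => u N + v N) (a + b).
Proof.
move=> [u1 u2] [v1 v2]; split.
- by rewrite ReD; under eq_fun do rewrite ReD; apply: cvgD.
- by rewrite ImD; under eq_fun do rewrite ImD; apply: cvgD.
Qed.

Lemma ReM (x y : C) : complex.Re (x * y) =
  complex.Re x * complex.Re y - complex.Im x * complex.Im y.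
Proof. by case: x y => [a b] [c d]. Qed.

Lemma ImM (x y : C) : complex.Im (x * y) =
  complex.Re x * complex.Im y + complex.Im x * complex.Re y.
Proof. by case: x y => [a b] [c d]. Qed.

Lemma ccvgM u v a b : ccvg u a -> ccvg v b -> ccvg (fun N => u N * v N) (a * b).
Proof.
move=> [u1 u2] [v1 v2]; split.
- rewrite ReM; under eq_fun do rewrite ReM.
  by apply: cvgB; apply: cvgM.
- rewrite ImM; under eq_fun do rewrite ImM.
  by apply: cvgD; apply: cvgM.
Qed.

Lemma ccvgN u a : ccvg u a -> ccvg (fun N => - u N) (- a).
Proof.
move=> ua; have := ccvgM (ccvg_cst (-1)) ua; rewrite mulN1r.
by under eq_fun do rewrite mulN1r.
Qed.

Lemma ccvgB u v a b : ccvg u a -> ccvg v b -> ccvg (fun N => u N - v N) (a - b).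
Proof. by move=> ua vb; apply: ccvgD => //; apply: ccvgN. Qed.

Lemma ccvg_sum (I : Type) (r : seq I) (P : pred I) (u : I -> nat -> C) (a : I -> C) :
  (forall i, ccvg (u i) (a i)) ->
  ccvg (fun N => \sum_(i <- r | P i) u i N) (\sum_(i <- r | P i) a i).
Proof.
move=> ua; elim: r => [|i r IHr].
  by rewrite big_nil; under eq_fun do rewrite big_nil; apply: ccvg_cst.
rewrite big_cons; under eq_fun do rewrite big_cons.
by case: (P i) => //; apply: ccvgD.
Qed.

Lemma ccvg_le u v a b : ccvg u a -> ccvg v b -> (forall N, u N <= v N) -> a <= b.
Proof.
move=> [u1 u2] [v1 v2] uv; rewrite lecE; apply/andP; split.
  (* Comparable complex numbers have equal imaginary parts, so the two imaginary sequences
     coincide. *)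
  apply/eqP; apply: (cvg_unique _ v2); rewrite //.
  suff <- : (fun N => complex.Im (u N)) = (fun N => complex.Im (v N)) by [].
  by apply/funext => N; have := uv N; rewrite lecE => /andP[/eqP].
apply: (ler_cvg_to u1 v1); near=> N.
by have := uv N; rewrite lecE => /andP[].
Unshelve. all: by end_near. Qed.

Lemma ccvgS u a : ccvg u a -> ccvg (fun N => u N.+1) a.
Proof.
move=> [u1 u2]; split.
- by rewrite (cvg_shiftS (fun N => complex.Re (u N))).
- by rewrite (cvg_shiftS (fun N => complex.Im (u N))).
Qed.

Lemma ccvg_nonincreasing u : (forall N, 0 <= u N) -> (forall N, u N.+1 <= u N) ->
  exists l, ccvg u l.
Proof.
move=> u0 uS.
pose v N := complex.Re (u N).
have v0 N : 0 <= v N by have := u0 N; rewrite lecE => /andP[].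
have vS : nonincreasing_seq v.
  by apply/nonincreasing_seqP => N; have := uS N; rewrite lecE => /andP[].
have vc : cvgn v by apply: nonincreasing_is_cvgn => //; exists 0 => _ [N _ <-].
exists (Complex (limn v) 0); split; first exact: vc.
under eq_fun do rewrite (ger0_Im (u0 _)); exact: cvg_cst.
Qed.

Definition mxcvg m n (M : nat -> 'M[C]_(m, n)) (L : 'M[C]_(m, n)) : Prop :=
  forall a b, ccvg (fun N => M N a b) (L a b).

Lemma mxcvg_cst m n (M : 'M[C]_(m, n)) : mxcvg (fun=> M) M.
Proof. by move=> a b; apply: ccvg_cst. Qed.

Lemma mxcvgD m n (M N : nat -> 'M[C]_(m, n)) L K :
  mxcvg M L -> mxcvg N K -> mxcvg (fun k => M k + N k) (L + K).
Proof.
by move=> h k a b; rewrite mxE; under eq_fun do rewrite mxE; apply: ccvgD.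
Qed.

Lemma mxcvgB m n (M N : nat -> 'M[C]_(m, n)) L K :
  mxcvg M L -> mxcvg N K -> mxcvg (fun k => M k - N k) (L - K).
Proof.
by move=> h k a b; rewrite !mxE; under eq_fun do rewrite !mxE; apply: ccvgB.
Qed.

Lemma mxcvgM m n p (M : nat -> 'M[C]_(m, n)) (N : nat -> 'M[C]_(n, p)) L K :
  mxcvg M L -> mxcvg N K -> mxcvg (fun k => M k *m N k) (L *m K).
Proof.
move=> h k a b; rewrite mxE; under eq_fun do rewrite mxE.
by apply: ccvg_sum => i; apply: ccvgM.
Qed.

Lemma mxcvg_sum m n (I : Type) (r : seq I) (P : pred I)
    (M : I -> nat -> 'M[C]_(m, n)) (L : I -> 'M[C]_(m, n)) :
  (forall i, mxcvg (M i) (L i)) ->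
  mxcvg (fun k => \sum_(i <- r | P i) M i k) (\sum_(i <- r | P i) L i).
Proof.
move=> h a b; rewrite summxE; under eq_fun do rewrite summxE.
by apply: ccvg_sum => i; apply: h.
Qed.

Lemma conjc_ReIm (x : C) : conjc x = Complex (complex.Re x) (- complex.Im x).
Proof. by case: x. Qed.

Lemma mxcvg_adj m n (M : nat -> 'M[C]_(m, n)) L :
  mxcvg M L -> mxcvg (fun k => adj (M k)) (adj L).
Proof.
move=> h a b; rewrite adjE; under eq_fun do rewrite adjE.
have [h1 h2] := h b a; split.
  by rewrite conjc_ReIm; under eq_fun do rewrite conjc_ReIm.
by rewrite conjc_ReIm; under eq_fun do rewrite conjc_ReIm; apply: cvgN.
Qed.

Lemma ccvg_qform n (M : nat -> 'M[C]_n) L x :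
  mxcvg M L -> ccvg (fun k => qform (M k) x) (qform L x).
Proof.
by move=> h; apply: mxcvgM (mxcvg_cst x) 0 0; apply: mxcvgM h; apply: mxcvg_cst.
Qed.

(** Monotone convergence gives a limit of the form at each vector; polarization turns these limits
    into limits of the entries. *)
Lemma psd_nonincreasing_mxcvg n (M : nat -> 'M[C]_n) :
  (forall N, psd (M N)) ->
  (forall N x, qform (M N.+1) x <= qform (M N) x) ->
  exists L, mxcvg M L.
Proof.
move=> M0 MS.
have ex x : exists l, ccvg (fun N => qform (M N) x) l.
  by apply: ccvg_nonincreasing => N; [apply: M0|apply: MS].
have [q qP] := choice ex.
pose e (a : 'I_n) : 'cV[C]_n := delta_mx a 0.
exists (\matrix_(a, b) (4^-1 * ((q (e a + 1 *: e b) - q (e a + (-1) *: e b)) -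
  'i%C * (q (e a + 'i%C *: e b) - q (e a + (- 'i%C) *: e b))))) => a b.
have E N : M N a b = 4^-1 * ((qform (M N) (e a + 1 *: e b) - qform (M N) (e a + (-1) *: e b)) -
  'i%C * (qform (M N) (e a + 'i%C *: e b) - qform (M N) (e a + (- 'i%C) *: e b))).
  by rewrite -polarization adj_delta_mul mulKf // pnatr_eq0.
rewrite mxE; under eq_fun do rewrite E.
apply: ccvgM; first exact: ccvg_cst.
apply: ccvgB; first by apply: ccvgB; apply: qP.
by apply: ccvgM; [exact: ccvg_cst|apply: ccvgB; apply: qP].
Qed.

Lemma qform_inj n (M N : 'M[C]_n) : (forall x, qform M x = qform N x) -> M = N.
Proof.
move=> MN; apply/matrixP => a b; rewrite -(adj_delta_mul M) -(adj_delta_mul N).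
have n4 : (4 : C) != 0 by rewrite pnatr_eq0.
by apply: (mulfI n4); rewrite !polarization (funext MN : qform M = qform N).
Qed.

End ComplexLimits.

(** * The required supply *)

Section RequiredSupply.
Variables (R : realType) (m n : nat).
Local Notation C := R[i].
Variables (Cm : 'M[C]_(m, n)) (A : 'M[C]_n).
Variables (E : 'M[C]_n) (G : 'M[C]_(n, m)) (K : 'M[C]_m).
Variable H : nat -> nat -> 'M[C]_m.
Hypotheses (obs : observable Cm A) (kerH : stein_kernel Cm A E G K H).
Hypothesis H0 : op_nonneg H.

(* [W] is the supply rate and [L] the state update, both on pairs [col_mx x u]. *)
Let W := block_mx E G (adj G) K.
Let L := row_mx (adj A) (adj Cm).

(** Least supply over inputs of length [N] that steer [0] to a given state. Attainment is built in,
    so that all states are reachable in [N] steps. *)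
Definition is_required_supply N (X : 'M[C]_n) : Prop :=
  [/\ psd X,
      forall x, exists2 u : nat -> 'cV[C]_m,
        ostate Cm A N u = x & kform H N u = qform X x &
      forall u : nat -> 'cV[C]_m, qform X (ostate Cm A N u) <= kform H N u].

Lemma required_supply_exists N (U : nat -> 'M[C]_(m, n)) :
  ostate Cm A N U = 1%:M -> exists X, is_required_supply N X.
Proof.
rewrite ostate_block_col => LU.
have [Z LZ Zmin] := min_qform_fiber (@H0 N) LU.
exists (adj Z *m section H N *m Z); split=> [|x|u]; first exact/psd_conj/H0.
- have [u uE] := block_colP (Z *m x); exists u.
    by rewrite ostate_block_col -uE mulmxA LZ mul1mx.
  by rewrite qform_conj uE qform_section.
- by rewrite ostate_block_col -qform_section; apply: Zmin.
Qed.

Lemma required_supply_nonincreasing N X X' :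
  is_required_supply N X -> is_required_supply N.+1 X' ->
  forall x, qform X' x <= qform X x.
Proof.
move=> [_ sX _] [_ _ X'min] x; have [u <- <-] := sX x.
(* Index [N] is the earliest instant: a zero input there leaves the system at rest and costs
   nothing. *)
pose v i := if (i < N)%N then u i else 0.
have -> : ostate Cm A N u = ostate Cm A N.+1 v.
  rewrite /ostate big_ord_recr /= /v ltnn mulmx0 addr0.
  by apply: eq_bigr => i _; rewrite ltn_ord.
have -> : kform H N u = kform H N.+1 v; last exact: X'min.
rewrite /kform; congr (fun_of_matrix _ _ _).
rewrite big_ord_recr /= [X in _ = _ + X]big1 ?addr0; last first.
  by move=> l _; rewrite /v ltnn adj0 !mul0mx.
apply: eq_bigr => i _; rewrite big_ord_recr /= {4}/v ltnn mulmx0 addr0.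
by apply: eq_bigr => l _; rewrite /v !ltn_ord.
Qed.

Lemma required_supply_dissipation N X X' x w :
  is_required_supply N X -> is_required_supply N.+1 X' ->
  qform X' (L *m col_mx x w) <= qform X x + qform W (col_mx x w).
Proof.
move=> [_ sX _] [_ _ X'min]; have [u ux uX] := sX x.
(* An optimal input reaching [x] is followed by [w]; the latest input sits at index [0], hence the
   shift. *)
pose v i := if i is i'.+1 then u i' else w.
have := X'min v; rewrite (kformS _ _ kerH) ostateS.
by rewrite -/W -[fun i => v i.+1]/u -[v 0%N]/w ux uX mul_row_col.
Qed.

(** Principle of optimality: deleting the last input of an optimal strategy for [x] leaves a
    strategy for the previous state [y], which costs at least [qform X y]. *)
Lemma required_supply_optimal_step N X X' x :
  is_required_supply N X -> is_required_supply N.+1 X' ->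
  exists y w, L *m col_mx y w = x /\
    qform X y + qform W (col_mx y w) <= qform X' x.
Proof.
move=> [_ _ Xmin] [_ sX' _]; have [u <- <-] := sX' x.
exists (ostate Cm A N (fun i => u i.+1)), (u 0%N).
by rewrite ostateS mul_row_col (kformS _ _ kerH) lerD2r; split => //; apply: Xmin.
Qed.

Lemma qform_block X x w :
  qform (block_mx (X + E) G (adj G) K) (col_mx x w) =
  qform X x + qform W (col_mx x w).
Proof.
rewrite /qform /W adj_col_mx !mul_row_block !mul_row_col mulmxDr !mulmxDl.
by rewrite -!addrA [in LHS]mxE.
Qed.

Lemma riccati_solution : exists X,
  [/\ psd X,
      psd (block_mx (X + E) G (adj G) K - adj L *m X *m L) &
      (\rank (block_mx (X + E) G (adj G) K - adj L *m X *m L)%R <= m)%N].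
Proof.
have [N0 [U UE]] := observable_right_inverse obs.
(* Horizons start at [N0], from which on every state is reachable. *)
have ex k : exists X, is_required_supply (N0 + k) X.
  by apply: (required_supply_exists (U := U)); apply: UE; rewrite leq_addr.
have [X XP] := choice ex.
have XPS k : is_required_supply (N0 + k).+1 (X k.+1) by rewrite -addnS.
have X0 k : psd (X k) by case: (XP k).
have Xmono k := required_supply_nonincreasing (XP k) (XPS k).
have [Y XY] := psd_nonincreasing_mxcvg X0 Xmono.
have cY x := ccvg_qform x XY.
have Y0 : psd Y.
  by move=> x; apply: (ccvg_le (ccvg_cst 0) (cY x)) => k; apply: X0.
have YX k x : qform Y x <= qform (X k) x.
  have mono j : qform (X (j + k)%N) x <= qform (X k) x.
    by elim: j => [//|j IHj]; exact: le_trans (Xmono (j + k)%N x) IHj.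
  have sh : ccvg (fun j => qform (X (j + k)%N) x) (qform Y x).
    elim: (k) => [|i IHi]; first by under eq_fun do rewrite addn0.
    by under eq_fun do rewrite addnS -addSn; apply: (ccvgS IHi).
  exact: (ccvg_le sh (ccvg_cst _)).
pose M := block_mx (Y + E) G (adj G) K.
have dissY v : qform Y (L *m v) <= qform M v.
  rewrite -[v]vsubmxK qform_block.
  apply: (ccvg_le (ccvgS (cY _)) (ccvgD (cY _) (ccvg_cst _))) => k.
  exact: required_supply_dissipation (XP k) (XPS k).
have M0 : psd M by move=> v; apply: le_trans (dissY v); apply: Y0.
(* Reachability at horizon [N0.+1], with the last input split off, exhibits a right inverse of the
   state update. *)
have [Z0 LZ0] : exists Z0, L *m Z0 = 1%:M.
  exists (col_mx (ostate Cm A N0 (fun i => U i.+1)) (U 0%N)).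
  by rewrite mul_row_col -ostateS; apply: UE.
have [Z LZ Zmin] := min_qform_fiber M0 LZ0.
(* Dynamic programming: the fibrewise minimum of [M] is [Y] itself. *)
have ZY : adj Z *m M *m Z = Y.
  apply: qform_inj => x; apply/eqP; rewrite eq_le; apply/andP; split; last first.
    by have := dissY (Z *m x); rewrite mulmxA LZ mul1mx qform_conj.
  apply: (ccvg_le (ccvg_cst _) (ccvgS (cY x))) => k.
  have [y [w [<- le]]] := required_supply_optimal_step x (XP k) (XPS k).
  apply: le_trans (Zmin _) _; apply: le_trans le.
  by rewrite qform_block lerD2r.
have N0' : psd (M - adj L *m Y *m L).
  move=> v; rewrite -/(qform _ v).
  have -> : qform (M - adj L *m Y *m L) v = qform M v - qform Y (L *m v).
    by rewrite -qform_conj /qform mulmxBr mulmxBl mxE [in X in _ + X]mxE.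
  by rewrite subr_ge0.
exists Y; split=> //.
rewrite -/M; have := @rank_min_qform_fiber R _ _ M L Z; rewrite ZY => /(_ N0' LZ).
by rewrite addKn.
Qed.

(** The factor of the residual form has as many columns as its rank. Cutting it into [n] upper and
    [m] lower rows gives [B] and [D], and comparing blocks gives the three equations. *)
Lemma riccati_factor : exists (X : 'M[C]_n) (r : nat) (B : 'M[C]_(n, r)) (D : 'M[C]_(m, r)),
  [/\ psd X, (r <= m)%N, E - B *m adj B = A *m X *m adj A - X,
      G - B *m adj D = A *m X *m adj Cm & K - D *m adj D = Cm *m X *m adj Cm].
Proof.
have [X [X0 N0 rN]] := riccati_solution.
have [r [V [rm VE]]] : exists r (V : 'M[C]_(n + m, r)), (r <= m)%N /\
    block_mx (X + E) G (adj G) K - adj L *m X *m L = V *m adj V.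
  by have [V VE] := psd_rank_factor N0; exists _, V.
exists X, r, (usubmx V), (dsubmx V).
move: VE; rewrite -{1 2}[V]vsubmxK adj_col_mx mul_col_row.
rewrite /L adj_row_mx !adjK mul_col_mx mul_col_row opp_block_mx add_block_mx.
case/eq_block_mx => h1 h2 _ h4; split=> //.
- by rewrite -h1 opprB [X + E]addrC opprD addrCA addNKr.
- by rewrite -h2 opprB addrC subrK.
- by rewrite -h4 opprB addrC subrK.
Qed.

End RequiredSupply.

(** * Gramians and powers of [A] *)

Section Gramians.
Variable R : realType.
Local Notation C := R[i].
Local Open Scope classical_set_scope.

Lemma is_gramianE n k (A : 'M[C]_n) (B : 'M[C]_(n, k)) P :
  is_gramian A B P <-> mxcvg (gramian_partial A B) P.
Proof. by split. Qed.

Lemma normc_sqr_ReIm (x : C) :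
  complex.Re (x * conjc x) = complex.Re x ^+ 2 + complex.Im x ^+ 2.
Proof. by case: x => a b /=; rewrite mulrN opprK -!expr2. Qed.

Lemma cvg_sqr_bound0 (u v : nat -> R) :
  v @ \oo --> (0 : R) -> (forall N, u N ^+ 2 <= v N) -> u @ \oo --> (0 : R).
Proof.
move=> /cvgrPdist_lt v0 uv; apply/cvgrPdist_lt => e e0.
have e2 : 0 < e ^+ 2 by rewrite exprn_gt0.
near=> N; rewrite sub0r normrN.
suff : `|u N| ^+ 2 < e ^+ 2 by rewrite ltr_sqr ?nnegrE ?(ltW e0).
rewrite real_normK ?num_real //.
apply: le_lt_trans (uv N) _; apply: le_lt_trans (ler_norm _) _.
by near: N; have := v0 _ e2; apply: filterS => N; rewrite sub0r normrN.
Unshelve. all: by end_near. Qed.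

(** A diagonal entry of [M N *m adj (M N)] is the sum of the squared moduli along a row, so it
    dominates each of them. *)
Lemma mxcvg_mul_adj0 m n (M : nat -> 'M[C]_(m, n)) :
  mxcvg (fun N => M N *m adj (M N)) 0 -> mxcvg M 0.
Proof.
move=> h a b; have [h1 _] := h a a; rewrite mxE /= in h1.
have bnd N : complex.Re (M N a b) ^+ 2 + complex.Im (M N a b) ^+ 2 <=
    complex.Re ((M N *m adj (M N)) a a).
  rewrite mxE (bigD1 b) //= ReD adjE normc_sqr_ReIm lerDl.
  rewrite (big_morph _ (@ReD R) (erefl : complex.Re (0 : C) = 0)); apply: sumr_ge0 => j _.
  by rewrite adjE normc_sqr_ReIm addr_ge0 ?sqr_ge0.
rewrite mxE; split; apply: (cvg_sqr_bound0 h1) => N; apply: le_trans (bnd N).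
  by rewrite lerDl sqr_ge0.
by rewrite lerDr sqr_ge0.
Qed.

(** The terms of a convergent series tend to [0], and the [N]-th term of the Gramian is
    [A ^+ N *m B] times its adjoint. *)
Lemma gramian_term_cvg0 n k (A : 'M[C]_n) (B : 'M[C]_(n, k)) P :
  is_gramian A B P -> mxcvg (fun N => A ^+ N *m B) 0.
Proof.
move=> /is_gramianE hP; apply: mxcvg_mul_adj0.
have -> : (fun N => A ^+ N *m B *m adj (A ^+ N *m B)) =
    fun N => gramian_partial A B N.+1 - gramian_partial A B N.
  apply/funext => N; rewrite {1}/gramian_partial big_ord_recr /=.
  by rewrite -/(gramian_partial A B N) [X in X - _]addrC addrK adjM adjX !mulmxA.
by rewrite -(subrr P); apply: (mxcvgB _ hP) => a b; apply: ccvgS (hP a b).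
Qed.

Lemma controllable_observable_adj n k (A : 'M[C]_n) (B : 'M[C]_(n, k)) :
  controllable A B -> observable (adj B) (adj A).
Proof.
move=> ctr x hx; rewrite -[x]adjK (ctr (adj x)) ?adj0 // => j.
by rewrite -[A]adjK -adjX -[B]adjK -!adjM mulmxA hx adj0.
Qed.

Lemma power_cvg0 n p q (A : 'M[C]_n) (B1 : 'M[C]_(n, p)) (B2 : 'M[C]_(n, q)) P1 P2 :
  controllable A (row_mx B1 B2) -> is_gramian A B1 P1 -> is_gramian A B2 P2 ->
  mxcvg (fun N => A ^+ N) 0.
Proof.
move=> /controllable_observable_adj/observable_right_inverse[N0 [U UE]] g1 g2.
have := UE _ (leqnn N0); set B := row_mx B1 B2 => {}UE.
have AB0 : mxcvg (fun N => A ^+ N *m B) 0.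
  move=> a b; rewrite /B; under eq_fun do rewrite mul_mx_row.
  rewrite mxE; case: (split_ordP b) => c ->.
    under eq_fun do rewrite row_mxEl.
    by have := gramian_term_cvg0 g1 a c; rewrite mxE.
  under eq_fun do rewrite row_mxEr.
  by have := gramian_term_cvg0 g2 a c; rewrite mxE.
(* Controllability writes the identity as [sum_i A^i B (U i)]. *)
have AE N : A ^+ N = \sum_(i < N0) A ^+ i *m (A ^+ N *m B) *m U i.
  rewrite -[LHS]mulmx1 -UE mulmx_sumr; apply: eq_bigr => i _.
  by rewrite adjM adjX !adjK !mulmxA !mulmxE -!exprD [(N + i)%N]addnC.
have -> : (fun N => A ^+ N) = fun N => \sum_(i < N0) A ^+ i *m (A ^+ N *m B) *m U i.
  exact/funext.
have lim0 : mxcvg (fun N => \sum_(i < N0) A ^+ i *m (A ^+ N *m B) *m U i)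
    (\sum_(i < N0) A ^+ i *m 0 *m U i).
  apply: mxcvg_sum => i; apply: mxcvgM (mxcvg_cst _).
  exact: mxcvgM (mxcvg_cst _) AB0.
by rewrite big1 // in lim0 => i _; rewrite mulmx0 mul0mx.
Qed.

(** Substituting [E + X - A *m X *m adj A] for [B *m adj B] makes the [X] terms telescope. *)
Lemma gramian_partial_stein n k (A : 'M[C]_n) (B : 'M[C]_(n, k)) E X N :
  E - B *m adj B = A *m X *m adj A - X ->
  gramian_partial A B N =
  \sum_(nu < N) A ^+ nu *m E *m adj A ^+ nu + X - A ^+ N *m X *m adj A ^+ N.
Proof.
move=> eqB; rewrite /gramian_partial; elim: N => [|N IHN].
  by rewrite !big_ord0 !expr0 mul1mx mulmx1 add0r subrr.
rewrite !big_ord_recr /= IHN.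
have -> : A ^+ N *m B *m adj B *m adj A ^+ N = A ^+ N *m (E + X - A *m X *m adj A) *m adj A ^+ N.
  rewrite -[_ *m B *m _]mulmxA; congr (_ *m _ *m _).
  have := eqB; move: (B *m adj B) (A *m X *m adj A) => b y hb.
  by rewrite -addrA -[X - y]opprB -hb opprB addrC subrK.
rewrite mulmxBr mulmxBl mulmxDr mulmxDl [in A ^+ N.+1]exprSr [in adj A ^+ N.+1]exprS -!mulmxE !mulmxA.
set S := \sum_(i < N) _.
move: S (_ *m E *m _) (_ *m X *m adj A ^+ N) (_ *m adj A *m _) => S t1 t2 t3.
by apply/matrixP => a b; rewrite !mxE; ring.
Qed.

Lemma gramian_stein n p q k (A : 'M[C]_n) (B1 : 'M[C]_(n, p)) (B2 : 'M[C]_(n, q))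
    (B : 'M[C]_(n, k)) P1 P2 X :
  mxcvg (fun N => A ^+ N) 0 -> is_gramian A B1 P1 -> is_gramian A B2 P2 ->
  B1 *m adj B1 - B2 *m adj B2 - B *m adj B = A *m X *m adj A - X ->
  is_gramian A B (X + P1 - P2).
Proof.
move=> A0 /is_gramianE g1 /is_gramianE g2 eqB; apply/is_gramianE.
have -> : gramian_partial A B = fun N =>
    (gramian_partial A B1 N - gramian_partial A B2 N) + X - A ^+ N *m X *m adj (A ^+ N).
  apply/funext => N; rewrite (gramian_partial_stein _ eqB) adjX; congr (_ + _ - _).
  rewrite /gramian_partial -sumrB; apply: eq_bigr => i _.
  by rewrite mulmxBr mulmxBl !mulmxA.
have -> : X + P1 - P2 = P1 - P2 + X - 0 *m X *m adj 0.
  by rewrite !mul0mx subr0 -addrA addrC.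
apply: mxcvgB; first by apply: mxcvgD (mxcvg_cst _); apply: mxcvgB.
by apply: mxcvgM (mxcvg_adj A0); apply: mxcvgM A0 (mxcvg_cst _).
Qed.

End Gramians.

(** * The identity on the unit circle *)

Section Circle.
Variable R : realType.
Local Notation C := R[i].

(** If the matrix were singular, [z^-1] would be an eigenvalue of [A] of modulus [1]. *)
Lemma stable_unitmx n (A : 'M[C]_n) (z : C) :
  stable A -> z * conjc z = 1 -> 1%:M - z *: A \in unitmx.
Proof.
move=> st zz; apply: contraT => ns.
have z0 : z != 0 by apply/eqP => z0; move: zz; rewrite z0 mul0r => /eqP; rewrite eq_sym oner_eq0.
have nz : `|z| = 1.
  by apply/eqP; rewrite -(@pexpr_eq1 _ _ 2) // sqr_normc zz.
have : eigenvalue A z^-1.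
  rewrite /eigenvalue /eigenspace kermx_eq0 row_free_unit.
  apply: contra ns => u; have -> : 1%:M - z *: A = - z *: (A - z^-1%:M).
    by rewrite scaleNr scalerBr opprB scale_scalar_mx divff.
  by rewrite unitmxZ // unitfE oppr_eq0.
by move/st; rewrite normfV nz invr1 ltxx.
Qed.

Lemma realize_mul_adj m n k (D : 'M[C]_(m, k)) (Cm : 'M[C]_(m, n)) (A : 'M[C]_n)
    (B : 'M[C]_(n, k)) (z : C) :
  let S := z *: (Cm *m invmx (1%:M - z *: A)) in
  realize D Cm A B z *m adj (realize D Cm A B z) =
  D *m adj D + S *m (B *m adj D) + adj (S *m (B *m adj D)) +
    S *m (B *m adj B) *m adj S.
Proof.
rewrite /realize scalemxAl; move: (z *: _) => S /=.
rewrite adjD !adjM adjK mulmxDl !mulmxDr !mulmxA.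
by rewrite -!addrA; congr (_ + _); rewrite addrCA.
Qed.

Lemma circle_identity m n p q r (Cm : 'M[C]_(m, n)) (A : 'M[C]_n)
    (B1 : 'M[C]_(n, p)) (B2 : 'M[C]_(n, q)) (B3 : 'M[C]_(n, r))
    (D1 : 'M[C]_(m, p)) (D2 : 'M[C]_(m, q)) (D3 : 'M[C]_(m, r)) X z :
  stable A -> z * conjc z = 1 -> adj X = X ->
  B1 *m adj B1 - B2 *m adj B2 - B3 *m adj B3 = A *m X *m adj A - X ->
  B1 *m adj D1 - B2 *m adj D2 - B3 *m adj D3 = A *m X *m adj Cm ->
  D1 *m adj D1 - D2 *m adj D2 - D3 *m adj D3 = Cm *m X *m adj Cm ->
  realize D1 Cm A B1 z *m adj (realize D1 Cm A B1 z)
  - realize D2 Cm A B2 z *m adj (realize D2 Cm A B2 z)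
  - realize D3 Cm A B3 z *m adj (realize D3 Cm A B3 z) = 0.
Proof.
move=> st zz XH eB eG eD.
rewrite !realize_mul_adj.
set T := Cm *m invmx (1%:M - z *: A); set S := z *: T.
(* The resolvent identity, from [T *m (1%:M - z *: A) = Cm]. *)
have TE : T = Cm + S *m A.
  have u := stable_unitmx st zz.
  have : T *m (1%:M - z *: A) = Cm by rewrite /T mulmxKV.
  rewrite mulmxBr mulmx1 -scalemxAr scalemxAl => <-.
  by rewrite subrK.
have -> : forall a1 a2 a3 b1 b2 b3 c1 c2 c3 d1 d2 d3 : 'M[C]_m,
   a1 + b1 + c1 + d1 - (a2 + b2 + c2 + d2) - (a3 + b3 + c3 + d3) =
   (a1 - a2 - a3) + (b1 - b2 - b3) + (c1 - c2 - c3) + (d1 - d2 - d3).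
  by move=> *; apply/matrixP => i j; rewrite !mxE; ring.
have eS : S *m (B1 *m adj D1) - S *m (B2 *m adj D2) - S *m (B3 *m adj D3) =
    S *m (A *m X *m adj Cm) by rewrite -eG !mulmxBr.
transitivity (Cm *m X *m adj Cm + S *m (A *m X *m adj Cm) +
    adj (S *m (A *m X *m adj Cm)) + S *m (A *m X *m adj A - X) *m adj S).
  congr (_ + _ + _ + _) => //; first by rewrite -eS !adjB.
  by rewrite -eB !(mulmxBr, mulmxBl).
(* This is where the modulus of [z] enters. Expanding the right side by [TE] then cancels the four
   remaining terms. *)
have E1 : S *m X *m adj S = T *m X *m adj T.
  by rewrite /S adjZmx -!scalemxAl -scalemxAr scalerA zz scale1r.
clearbody S T; rewrite mulmxBr mulmxBl E1 TE adjD !adjM XH adjK !mulmxDl !mulmxDr !mulmxA.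
move: (Cm *m X *m adj Cm) (S *m A *m X *m adj Cm) => t1 t2.
move: (Cm *m X *m adj A *m adj S) (S *m A *m X *m adj A *m adj S) => t3 t4.
by apply/matrixP => i j; rewrite !mxE; ring.
Qed.

End Circle.

Unset Implicit Arguments.

Theorem theorem1p1 (R : realType) (m p q n : nat)
  (A : 'M[R[i]]_n) (Cm : 'M[R[i]]_(m, n))
  (B1 : 'M[R[i]]_(n, p)) (B2 : 'M[R[i]]_(n, q))
  (D1 : 'M[R[i]]_(m, p)) (D2 : 'M[R[i]]_(m, q))
  (P1 P2 : 'M[R[i]]_n) :
  stable A ->
  minimal_realization Cm A (row_mx B1 B2) ->
  is_gramian A B1 P1 ->
  is_gramian A B2 P2 ->
  op_nonneg (fun i l => TTstar (coef D1 Cm A B1) i l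
                        - TTstar (coef D2 Cm A B2) i l) ->
  exists (r : nat) (B3 : 'M[R[i]]_(n, r)) (D3 : 'M[R[i]]_(m, r))
         (P3 : 'M[R[i]]_n),
    (r <= m)%N /\ is_gramian A B3 P3 /\
      [/\
        (* (i) *)
        (forall i l : nat,
            TTstar (coef D1 Cm A B1) i l - TTstar (coef D2 Cm A B2) i l
            - TTstar (coef D3 Cm A B3) i l
            = WXWstar Cm A (P3 + P2 - P1) i l),
        (* (ii) *)
        psd (P3 + P2 - P1),
        (* in particular *)
        op_nonneg (fun i l => TTstar (coef D1 Cm A B1) i l
                              - TTstar (coef D2 Cm A B2) i l
                              - TTstar (coef D3 Cm A B3) i l),
        op_rank_le (fun i l => TTstar (coef D1 Cm A B1) i l
                               - TTstar (coef D2 Cm A B2) i l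
                               - TTstar (coef D3 Cm A B3) i l) n
      & forall t : R, 0 <= t <= 2 * pi ->
          let z := Complex (cos t) (sin t) in
          realize D1 Cm A B1 z *m adj (realize D1 Cm A B1 z)
          - realize D2 Cm A B2 z *m adj (realize D2 Cm A B2 z)
          - realize D3 Cm A B3 z *m adj (realize D3 Cm A B3 z) = 0].
Proof.
move=> st [obs ctr] g1 g2 H0.
have kH := stein_kernelB (stein_kernel_TTstar Cm A B1 D1) (stein_kernel_TTstar Cm A B2 D2).
have [X [r [B3 [D3 [X0 rm eB eG eD]]]]] := riccati_factor obs kH H0.
(* The choice of [P3] is forced by requiring [P3 + P2 - P1 = X]. *)
exists r, B3, D3, (X + P1 - P2).
have XE : X + P1 - P2 + P2 - P1 = X by rewrite subrK addrK.
have XH := psd_adj X0.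
(* By the three equations for [X], both sides have the same border and diagonal increments. *)
have kerE i l : TTstar (coef D1 Cm A B1) i l - TTstar (coef D2 Cm A B2) i l
    - TTstar (coef D3 Cm A B3) i l = WXWstar Cm A X i l.
  have kF := stein_kernelB kH (stein_kernel_TTstar Cm A B3 D3).
  rewrite eB eG eD in kF.
  exact: stein_kernel_uniq kF (stein_kernel_WXWstar Cm A XH) i l.
have kerEf : (fun i l => TTstar (coef D1 Cm A B1) i l - TTstar (coef D2 Cm A B2) i l
    - TTstar (coef D3 Cm A B3) i l) = WXWstar Cm A X.
  by apply/funext => i; apply/funext => l; apply: kerE.
split=> //; split; first exact: gramian_stein (power_cvg0 ctr g1 g2) g1 g2 eB.
rewrite XE; split => //.
- rewrite kerEf => N; rewrite section_WXWstar -{1}[block_col _ _]adjK.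
  exact: psd_conj.
(* Each section factors through the state space, of dimension [n]. *)
- rewrite kerEf => N; rewrite section_WXWstar -mulmxA.
  exact: leq_trans (mxrankM_maxl _ _) (rank_leq_col _).
- move=> t _ z; apply: circle_identity eB eG eD => //.
  by apply/eqP; rewrite eq_complex /= mulrN opprK -!expr2 cos2Dsin2 mulrN mulrC addNr !eqxx.
Qed.
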